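(* Let $\kappa$ be an infinite cardinal, regarded as a discrete topological space. Then the following statements are true: (1) The space $(\ell^\infty(\kappa),\|\cdot\|_{\ell^\infty})$ can be isometrically embedded into the space $(\mathrm{Met}(\kappa),\mathcal{D}_\kappa)$. In particular, the space $(\mathrm{Met}(\kappa),\mathcal{D}_\kappa)$ is universal for $\mathscr{S}_\kappa$. (2) The space $(\mathrm{BMet}(\kappa),\mathcal{D}_\kappa)$ is universal for $\mathrm{B}(\mathscr{S}_\kappa)$.
   Context: For a metrizable space $Z$, $\mathrm{Met}(Z)$ is the set of all metrics on $Z$ that generate the given topology of $Z$, and $\mathrm{BMet}(Z)$ is the set of all bounded metrics in $\mathrm{Met}(Z)$. The sup-metric is $\mathcal{D}_Z(d,e)=\sup_{x,y\in Z}|d(x,y)-e(x,y)|$ (a priori possibly taking the value $\infty$); subsets carry its restriction. For a set $S$, $\ell^\infty(S)$ is the set of all bounded functions $S\to\mathbb{R}$ with the metric induced by the sup-norm $\|\cdot\|_{\ell^\infty}$. A space $(M,\rho)$ is universal for a class of metric spaces if every member of the class admits an isometric (distance-preserving) embedding into $(M,\rho)$. $\mathscr{S}_\kappa$ is the class of all metric spaces of weight $\kappa$ (with the convention that $\mathscr{S}_{\aleph_0}$ is the class of all separable metric spaces), and $\mathrm{B}(\mathscr{S}_\kappa)$ is the class of all bounded members of $\mathscr{S}_\kappa$. *)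

(* Defs.v *)
From HB Require Import structures.
From mathcomp Require Import all_boot all_order all_algebra.
From mathcomp Require Import all_classical all_reals all_analysis.

Set Implicit Arguments.
Unset Strict Implicit.
Unset Printing Implicit Defensive.

Import Order.TTheory GRing.Theory Num.Theory.
Import numFieldNormedType.Exports.

Local Open Scope classical_set_scope.
Local Open Scope ring_scope.

Section metrics.
Context {R : realType}.

Definition is_metric (T : Type) (d : T -> T -> R) : Prop :=
  [/\ forall x y, 0 <= d x y,
      forall x y, d x y = 0 <-> x = y,
      forall x y, d x y = d y x
    & forall x y z, d x z <= d x y + d y z].

Definition generates_topology (Z : topologicalType) (d : Z -> Z -> R) : Prop :=
  forall A : set Z, open A <->
    (forall x, A x -> exists2 e : R, 0 < e & [set y | d x y < e] `<=` A).

Definition bounded_dist (T : Type) (d : T -> T -> R) : Prop :=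
  exists M : R, forall x y, d x y <= M.

Definition Met (Z : topologicalType) : set (Z -> Z -> R) :=
  [set d | is_metric d /\ generates_topology d].

Definition BMet (Z : topologicalType) : set (Z -> Z -> R) :=
  [set d | Met d /\ bounded_dist d].

(* Only meaningful for nonempty [Z]: the supremum of the empty set in
   [\bar R] is [-oo]. *)
Definition sup_metric (Z : Type) (d e : Z -> Z -> R) : \bar R :=
  ereal_sup (range (fun p : Z * Z => (`|d p.1 p.2 - e p.1 p.2|)%:E)).

Definition linfty (S : Type) : set (S -> R) := bounded_fun.

Definition linfty_norm (S : Type) (f : S -> R) : R :=
  sup (range (fun x => `|f x|)).

Definition linfty_dist (S : Type) (f g : S -> R) : R :=
  linfty_norm (f \- g).

(* Distances are extended-real valued because [sup_metric] may be infinite. *)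
Definition isometrically_embeds (T U : Type)
    (A : set T) (dA : T -> T -> \bar R) (B : set U) (dB : U -> U -> \bar R) :
    Prop :=
  exists2 F : T -> U, set_fun A B F &
    forall x y, A x -> A y -> dB (F x) (F y) = dA x y.

Definition universal (C : metricType R -> Prop)
    (U : Type) (M : set U) (rho : U -> U -> \bar R) : Prop :=
  forall X : metricType R, C X ->
    isometrically_embeds [set: X] (fun x y => (mdist x y)%:E) M rho.

End metrics.

Definition separable (X : topologicalType) : Prop :=
  exists2 D : set X, countable D & dense D.

(* The weight of [X], i.e. the least cardinality of a basis, is that of [K]. *)
Definition has_weight (X : topologicalType) (K : Type) : Prop :=
  (exists2 B : set (set X), basis B & (B #= [set: K])%card) /\
  (forall B : set (set X), basis B -> ([set: K] #<= B)%card).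

(* A cardinal is represented by a type [K] of that cardinality. *)
Definition weight_class {R : realType} (K : Type) (X : metricType R) : Prop :=
  (([set: K] #= [set: nat])%card -> separable X) /\
  (~ ([set: K] #= [set: nat])%card -> has_weight X K).

Definition bounded_weight_class {R : realType} (K : Type) (X : metricType R) :
    Prop :=
  weight_class K X /\ bounded_dist (@mdist R X).

(* Main.v *)
(* A function [r >= 1] on a discrete space yields the ultrametric
   [d_r(p, q) = max (r p) (r q)] for [p <> q]. If all the functions considered
   take their least value 1 at a common point [q], then [d_r(p, q) = r p], so
   [r |-> d_r] is an isometry from the sup-distance to the sup-metric. Since
   [K] maps onto [K * nat], a function [f] on [K] can be stored in such an [r]
   by clamping and shifting: [r(k, n) = 1 + n + clamp_n (f k)]. Universality
   follows from the Kuratowski embedding along a dense family indexed by [K];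
   for bounded [X] no clamping is needed, because the functions
   [1 + d(x, _)] are already [>= 1], and the metrics obtained are bounded. *)
Require Import Defs.
From HB Require Import structures.
From mathcomp Require Import all_boot all_order all_algebra.
From mathcomp Require Import all_classical all_reals all_analysis.
From mathcomp Require Import lra.

Set Implicit Arguments.
Unset Strict Implicit.
Unset Printing Implicit Defensive.

Import Order.TTheory GRing.Theory Num.Theory.
Import numFieldNormedType.Exports.

Local Open Scope classical_set_scope.
Local Open Scope ring_scope.

(** * Surjection of an infinite set onto its product with the naturals *)

Lemma card_le_range (T U : Type) (A : set T) :
  (A #<= [set: U])%card -> A !=set0 -> exists e : U -> T, A `<=` range e.
Proof.
move=> /pfcard_geP[-> [x []]//|[e] _].
by exists e => x /(@surj _ _ _ _ e)[u _ <-]; exists u.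
Qed.

(** The case [f = g] forces each sequence to be injective; distinct ones have disjoint ranges. *)
Definition disjoint_sequences (K : Type) : set (set (nat -> K)) :=
  [set F | forall f g m n, F f -> F g -> f m = g n -> f = g /\ m = n].

(** By Zorn: if a maximal family missed infinitely many points, an injective sequence [h] of missed
    points could be added to it. *)
Lemma maximal_disjoint_sequences (K : Type) :
  exists F : set (nat -> K), disjoint_sequences F /\
    ~ infinite_set [set k | forall f n, F f -> f n <> k].
Proof.
have [C CD totC|F [Fdisj Fmax]] := @Zorn_bigcup _ (@disjoint_sequences K).
  move=> f g m n [X CX Xf] [Y CY Yg].
  have [XY|YX] := totC _ _ CX CY.
    exact: (CD _ CY) (XY _ Xf) Yg.
  exact: (CD _ CX) Xf (YX _ Yg).
exists F; split=> // /infiniteP/card_leP[i].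
pose h n := set_val (i (to_setT n)).
have hF n f m : F f -> f m <> h n by exact: set_valP (i (to_setT n)) f m.
have h_inj : injective h.
  move=> m n /val_inj/(@inj _ _ _ i) mn.
  by apply: (congr1 val (mn _ _)); rewrite inE.
apply: (Fmax (F `|` [set h])).
  split=> [f|/(_ h (or_intror erefl)) Fh]; first by left.
  exact: (hF 0%N _ 0%N Fh).
move=> f g m n [Ff|->] [Fg|->].
- exact: Fdisj.
- by move=> /hF; case.
- by move=> /esym/hF; case.
- by move=> /h_inj.
Qed.

(* Partition [K], up to a finite set, into sequences; absorb the finite set
   into one of them, and use that [nat * nat] is countable on each. *)
Lemma infinite_surj_prod_nat (K : Type) : infinite_set [set: K] ->
  exists psi : K -> K * nat, forall p, exists k, psi k = p.
Proof.
move=> Kinf; have [F [Fdisj]] := maximal_disjoint_sequences K.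
set L := [set k | _] => /contrapT Lfin.
have [f0 Ff0] : F !=set0.
  apply/set0P; apply: contra_notN Kinf => /eqP F0.
  by apply: sub_finite_set Lfin => k _ f n; rewrite F0.
(* [e0] takes the place of [f0] and also runs through the finite leftover [L]. *)
have [e0 e0P] : exists e : nat -> K, L `|` range f0 `<=` range e.
  apply: card_le_range; last by exists (f0 0%N); right; exists 0%N.
  rewrite -bigcup2E; apply: bigcup_countable => // -[|[|n]] _ //=.
    exact: finite_set_countable.
  exact: sub_countable (card_image_le _ _) _.
have [c cP] : exists c : nat -> nat * nat, [set: nat * nat] `<=` range c.
  apply: card_le_range; last by exists (0%N, 0%N).
  by have := card_nat2; rewrite card_eq_le => /andP[].
pose u (f : nat -> K) := if pselect (f = f0) then e0 else f.
(* The [n]-th term of [f] goes to the pair [c n] with [u f] applied to its first entry; disjointness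
   makes this well defined. Points on no sequence get an arbitrary value. *)
have /choice[psi psiP] k : exists p : K * nat,
    forall f n, F f -> f n = k -> p = (u f (c n).1, (c n).2).
  have [[f [n [Ff fnk]]]|no] := pselect (exists f n, F f /\ f n = k).
    exists (u f (c n).1, (c n).2) => g m Fg gmk.
    by have [-> ->] : f = g /\ n = m by apply: Fdisj => //; rewrite fnk.
  by exists (k, 0%N) => f n Ff fnk; exfalso; apply: no; exists f, n.
exists psi => -[k j].
have [f [a [Ff <-]]] : exists f a, F f /\ u f a = k.
  have [[f [n [Ff fnk]]]|no] := pselect (exists f n, F f /\ f n = k).
    have [ff0|ff0] := pselect (f = f0); last first.
      by exists f, n; rewrite /u; case: pselect.
    have [|a _ ak] := e0P k; first by right; exists n; rewrite -?ff0.
    by exists f0, a; rewrite /u; case: pselect.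
  have [|a _ ak] := e0P k.
    by left => f n Ff fnk; apply: no; exists f, n.
  by exists f0, a; rewrite /u; case: pselect.
have [n _ cn] := cP (a, j) I.
by exists (f n); rewrite (psiP _ f n)// cn.
Qed.

(** * Ultrametrics built from a maximum *)

Section max_metric.
Context {R : realType} {T : eqType}.

Definition max_metric (r : T -> R) (p q : T) : R :=
  if p == q then 0 else Num.max (r p) (r q).

Lemma is_metric_max_metric (r : T -> R) :
  (forall p, 1 <= r p) -> is_metric (max_metric r).
Proof.
move=> r1.
have r0 p : 0 < r p by apply: lt_le_trans (r1 p).
rewrite /max_metric; split=> [p q|p q|p q|p q s].
- by case: eqVneq => // _; rewrite le_max ltW.
- case: eqVneq => // pq; split=> [/eqP|pq'].
    by rewrite gt_eqF// lt_max r0.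
  by rewrite pq' eqxx in pq.
- by rewrite eq_sym maxC.
- have p0 := r0 p; have q0 := r0 q; have s0 := r0 s.
  have [->|pq] := eqVneq p q; first by rewrite add0r.
  have [<-|qs] := eqVneq q s; first by rewrite addr0 (negbTE pq).
  case: eqVneq => _; first by rewrite addr_ge0// le_max ltW.
  by case: (leP (r p) (r s)); case: (leP (r p) (r q));
    case: (leP (r q) (r s)); lra.
Qed.

(** The maximum of two reals is nonexpansive for the sup-norm. *)
Lemma max_metric_sub_le (r r' : T -> R) p q (e : R) : 0 <= e ->
  `|r p - r' p| <= e -> `|r q - r' q| <= e ->
  `|max_metric r p q - max_metric r' p q| <= e.
Proof.
rewrite /max_metric; case: eqVneq => [_|_] e0; first by rewrite subrr normr0.
rewrite !ler_norml.
by case: (leP (r p) (r q)); case: (leP (r' p) (r' q)); lra.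
Qed.

(* The function [r] is recovered from the distances to a point where
   it takes its least value. *)
Lemma sup_metric_max_metric (r r' : T -> R) (q : T) :
  (forall p, 1 <= r p) -> (forall p, 1 <= r' p) -> r q = 1 -> r' q = 1 ->
  sup_metric (max_metric r) (max_metric r') =
  ereal_sup (range (fun p => (`|r p - r' p|)%:E)).
Proof.
move=> r1 r'1 rq r'q; apply/eqP; rewrite eq_le; apply/andP; split.
- apply: ge_ereal_sup => _ [[p s] _ <-] /=.
  have [ps|sp] := leP `|r p - r' p| `|r s - r' s|.
    apply: le_ereal_sup_tmp; exists (`|r s - r' s|)%:E; first by exists s.
    by rewrite lee_fin max_metric_sub_le.
  apply: le_ereal_sup_tmp; exists (`|r p - r' p|)%:E; first by exists p.
  by rewrite lee_fin max_metric_sub_le// ltW.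
- apply: ge_ereal_sup => _ [p _ <-].
  apply: le_ereal_sup_tmp.
  exists (`|max_metric r p q - max_metric r' p q|)%:E; first by exists (p, q).
  rewrite lee_fin /max_metric; case: eqVneq => [->|_].
    by rewrite rq r'q !subrr.
  by rewrite rq r'q !max_l.
Qed.

End max_metric.

Lemma Met_max_metric (R : realType) (K : discreteTopologicalType) (r : K -> R) :
  (forall p, 1 <= r p) -> Met (max_metric r).
Proof.
move=> r1; split; first exact: is_metric_max_metric.
move=> A; split=> [_ p Ap|_]; last exact: discrete_open.
(* Distinct points are at distance at least 1, so this ball is a singleton. *)
exists 1 => // q /=; rewrite /max_metric; case: eqVneq => [<-//|_].
by rewrite gt_max ltNge r1.
Qed.

(** * Embedding of bounded functions into metrics *)

Lemma isometrically_embeds_trans (R : realType) (T U V : Type)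
    (A : set T) (dA : T -> T -> \bar R) (B : set U) (dB : U -> U -> \bar R)
    (C : set V) (dC : V -> V -> \bar R) :
  isometrically_embeds A dA B dB -> isometrically_embeds B dB C dC ->
  isometrically_embeds A dA C dC.
Proof.
move=> [F FAB Fiso] [G GBC Giso]; exists (G \o F) => [x Ax|x y Ax Ay].
  exact/GBC/FAB.
by rewrite -Fiso//= Giso//; exact: FAB.
Qed.

(** Nonemptiness and boundedness keep the real [sup] away from its default value, so it agrees with
    the extended supremum. *)
Lemma linfty_distE (R : realType) (K : Type) (f g : K -> R) : [set: K] !=set0 ->
  linfty f -> linfty g ->
  (linfty_dist f g)%:E = ereal_sup (range (fun k => (`|f k - g k|)%:E)).
Proof.
move=> [k0 _] fb gb; rewrite /linfty_dist /linfty_norm -ereal_sup_EFin.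
- by rewrite image_comp.
- have [M [Mr MP]] := fb; have [N [Nr NP]] := gb.
  (* Boundedness is stated for every real strictly above [M], hence the added 1. *)
  exists (`|M| + 1 + (`|N| + 1)) => _ [k _ <-].
  rewrite (le_trans (ler_normB _ _))// lerD//.
    by apply: MP => //; rewrite ltr_pwDr// ler_norm.
  by apply: NP => //; rewrite ltr_pwDr// ler_norm.
- by exists (`|f k0 - g k0|), k0.
Qed.

Lemma clamp_id (R : realType) (a x : R) :
  `|x| <= a -> Num.max (- a) (Num.min a x) = x.
Proof. by rewrite ler_norml => /andP[ax xa]; rewrite min_r// max_r. Qed.

Lemma clamp_ge (R : realType) (a x : R) : - a <= Num.max (- a) (Num.min a x).
Proof. by rewrite le_max lexx. Qed.

Lemma clamp_sub_le (R : realType) (a x y : R) :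
  `|Num.max (- a) (Num.min a x) - Num.max (- a) (Num.min a y)| <= `|x - y|.
Proof.
have := ler_norm (x - y); have := ler_norm (y - x).
rewrite (distrC y x) => yx xy.
rewrite ler_norml.
case: (leP a x) => ax; case: (leP a y) => ay; case: (leP (- a) a) => aa;
  by case: (leP (- a) x) => ax'; case: (leP (- a) y) => ay'; lra.
Qed.

(* Distances are bounded below by 1, so [f] can only be encoded after being
   clamped to [[- n, n]] and shifted by [n]; all [n] are needed since [f]
   ranges over functions with arbitrarily large bounds. *)
Lemma linfty_embeds_Met (R : realType) (K : discreteTopologicalType) :
  infinite_set [set: K] ->
  isometrically_embeds (@linfty R K) (fun f g => (linfty_dist f g)%:E)
    (@Met R K) (@sup_metric R K).
Proof.
move=> Kinf; have [psi psiP] := infinite_surj_prod_nat Kinf.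
have [k0 _] := infinite_setN0 Kinf.
pose h (a : R) (x : R) := Num.max (- a) (Num.min a x).
pose r (f : K -> R) k := 1 + (psi k).2%:R + h (psi k).2%:R (f (psi k).1).
have r1 f k : 1 <= r f k.
  by have := clamp_ge (psi k).2%:R (f (psi k).1); rewrite /r /h; lra.
(* At level 0 the clamp is to [[0, 0]], so every [r f] takes its least value 1 at [q]. *)
have [q psiq] := psiP (k0, 0%N).
have rq f : r f q = 1.
  rewrite /r psiq /= /h oppr0 addr0 max_l ?addr0//.
  by rewrite ge_min lexx.
exists (fun f => max_metric (r f)) => [f _|f g fb gb].
  exact: Met_max_metric.
rewrite (sup_metric_max_metric (q := q))// linfty_distE//; last by exists k0.
apply/eqP; rewrite eq_le; apply/andP; split; apply: ge_ereal_sup => _ [k _ <-].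
- apply: le_ereal_sup_tmp; exists (`|f (psi k).1 - g (psi k).1|)%:E.
    by exists (psi k).1.
  by rewrite lee_fin /r opprD addrACA subrr add0r clamp_sub_le.
(* A level above both absolute values clamps neither [f k] nor [g k], so their difference is
   attained. *)
- have [j psij] := psiP (k, Num.bound (`|f k| + `|g k|)).
  apply: le_ereal_sup_tmp; exists (`|r f j - r g j|)%:E; first by exists j.
  have fg_lt : `|f k| + `|g k| < (Num.bound (`|f k| + `|g k|))%:R.
    by apply: archi_boundP; rewrite addr_ge0.
  have f0 := normr_ge0 (f k); have g0 := normr_ge0 (g k).
  rewrite lee_fin /r psij /= /h opprD addrACA subrr add0r !clamp_id//; lra.
Qed.

(** * Dense families and the Kuratowski embedding *)

(** The triangle inequality bounds each term; at [e k] near [x] the term falls short of [mdist x y]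
    by at most [2 * mdist x (e k)]. *)
Lemma ereal_sup_mdist_dense (R : realType) (X : metricType R) (K : Type)
    (e : K -> X) (x y : X) : dense (range e) ->
  ereal_sup (range (fun k => (`|mdist x (e k) - mdist y (e k)|)%:E)) =
  (mdist x y)%:E.
Proof.
move=> e_dense; apply/eqP; rewrite eq_le; apply/andP; split.
  apply: ge_ereal_sup => _ [k _ <-]; rewrite lee_fin ler_norml.
  have := metric_triangle x y (e k); have := metric_triangle y x (e k).
  by rewrite (metric_sym y x); lra.
apply/lee_addgt0Pr => eps eps0.
have e2 : 0 < eps / 2 by rewrite divr_gt0.
have [z [xz [k _ ekz]]] : (ball x (eps / 2))° `&` range e !=set0.
  apply: e_dense; last exact: open_interior.
  by exists x; exact: nbhsx_ballx.
move: xz => /interior_subset; rewrite -{z}ekz ballEmdist /= => xk.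
apply: (@le_trans _ _ ((`|mdist x (e k) - mdist y (e k)|)%:E + eps%:E)%E).
  rewrite -EFinD lee_fin.
  have := metric_triangle x (e k) y; rewrite (metric_sym (e k) y).
  by have := ler_norm (mdist y (e k) - mdist x (e k));
    rewrite (distrC (mdist y _)); lra.
by apply: leeD => //; apply: ereal_sup_ubound; exists k.
Qed.

Lemma weight_class_dense (R : realType) (K : Type) (X : metricType R) :
  weight_class K X -> [set: X] !=set0 ->
  exists e : K -> X, dense (range e).
Proof.
move=> [sepX wX] [x0 _].
suff [D DK Dd] : exists2 D : set X, (D #<= [set: K])%card & dense D.
  have [|e De] := card_le_range DK.
    have [x [_ Dx]] : setT `&` D !=set0.
      by apply: Dd; [exists x0|exact: openT].
    by exists x.
  by exists e => O O0 oO; have [x [Ox /De]] := Dd O O0 oO; exists x.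
have [KN|KN] := pselect ([set: K] #= [set: nat])%card.
  have [D cD Dd] := sepX KN; exists D => //.
  by apply: card_le_trans cD _; rewrite (card_le_eqr KN).
have [[B [Bo Bb] BK] _] := wX KN.
(* One point from each nonempty basic set gives a dense set; [x0] is a default for the empty one. *)
have /choice[pt ptP] (U : set X) : exists x, U !=set0 -> U x.
  have [[x Ux]|U0] := pselect (U !=set0); first by exists x.
  by exists x0.
exists (pt @` B).
  apply: card_le_trans (card_image_le _ _) _.
  by move: BK; rewrite card_eq_le => /andP[].
move=> O [x Ox] oO.
have [U [BU Ux] UO] := Bb x O (open_nbhs_nbhs (conj oO Ox)).
exists (pt U); split; last by exists U.
by apply: UO; apply: ptP; exists x.
Qed.

Lemma empty_embeds (R : realType) (T U : Type) (dT : T -> T -> \bar R)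
    (B : set U) (dB : U -> U -> \bar R) : ~ ([set: T] !=set0) ->
  isometrically_embeds [set: T] dT B dB.
Proof.
move=> T0; have noT (t : T) : False by apply: T0; exists t.
by exists (fun t => False_rect U (noT t)) => t; case: (noT t).
Qed.

Lemma universal_linfty (R : realType) (K : Type) : [set: K] !=set0 ->
  universal (@weight_class R K) (@linfty R K)
    (fun f g => (linfty_dist f g)%:E).
Proof.
move=> K0 X XK.
have [X0|] := pselect ([set: X] !=set0); last exact: empty_embeds.
have [e e_dense] := weight_class_dense XK X0; have [x0 _] := X0.
(* Subtracting the distances from [x0] makes [F x] bounded by [mdist x x0] and cancels in
   differences. *)
pose F (x : X) k := mdist x (e k) - mdist x0 (e k).
have Fb x : linfty (F x).
  exists (mdist x x0); split; first exact: num_real.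
  move=> M /ltW xM k _ /=; apply: le_trans xM; rewrite ler_norml /F.
  have := metric_triangle x x0 (e k); have := metric_triangle x0 x (e k).
  by rewrite (metric_sym x0 x); lra.
exists F => // x y _ _.
rewrite linfty_distE// -(ereal_sup_mdist_dense _ _ e_dense).
congr ereal_sup; congr (_ @` _); apply/funext => k.
by rewrite /F opprB addrA subrK.
Qed.

Lemma universal_BMet (R : realType) (K : discreteTopologicalType) :
  infinite_set [set: K] ->
  universal (@bounded_weight_class R K) (@BMet R K) (@sup_metric R K).
Proof.
move=> Kinf X [XK [M XM]].
have [X0|] := pselect ([set: X] !=set0); last exact: empty_embeds.
have [e e_dense] := weight_class_dense XK X0.
have [psi psiP] := infinite_surj_prod_nat Kinf.
have [k0 _] := infinite_setN0 Kinf.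
have [q psiq] := psiP (k0, 0%N).
(* Level 0 is reserved for the common minimum at [q]; level 1 already carries all the distances. *)
pose r (x : X) k : R :=
  if (psi k).2 == 0%N then 1 else 1 + mdist x (e (psi k).1).
have r1 x k : 1 <= r x k.
  by rewrite /r; case: ifP => // _; rewrite lerDl mdist_ge0.
have rq x : r x q = 1 by rewrite /r psiq.
exists (fun x => max_metric (r x)) => [x _|x y _ _].
  split; first exact: Met_max_metric.
  have rM k : r x k <= 1 + `|M|.
    rewrite /r; case: ifP => _; first by rewrite lerDl.
    by rewrite lerD2l (le_trans (XM _ _))// ler_norm.
  exists (1 + `|M|) => a b; rewrite /max_metric; case: ifP => _.
    by rewrite addr_ge0.
  by rewrite ge_max !rM.
rewrite (sup_metric_max_metric (q := q))// -(ereal_sup_mdist_dense _ _ e_dense).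
apply/eqP; rewrite eq_le; apply/andP; split; apply: ge_ereal_sup => _ [k _ <-].
- apply: le_ereal_sup_tmp.
  exists (`|mdist x (e (psi k).1) - mdist y (e (psi k).1)|)%:E.
    by exists (psi k).1.
  rewrite lee_fin /r; case: ifP => _; first by rewrite subrr normr0.
  by rewrite opprD addrACA subrr add0r.
- have [j psij] := psiP (k, 1%N).
  apply: le_ereal_sup_tmp; exists (`|r x j - r y j|)%:E; first by exists j.
  by rewrite /r psij /= opprD addrACA subrr add0r.
Qed.

Theorem theorem1p5 (R : realType) (K : discreteTopologicalType)
    (K_infinite : infinite_set [set: K]) :
  (isometrically_embeds
     (@linfty R K) (fun f g => (linfty_dist f g)%:E)
     (@Met R K) (@sup_metric R K) /\
   universal (@weight_class R K) (@Met R K) (@sup_metric R K)) /\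
  universal (@bounded_weight_class R K) (@BMet R K) (@sup_metric R K).
Proof.
have lM := @linfty_embeds_Met R K K_infinite.
split; last exact: universal_BMet.
split=> // X XK.
apply: isometrically_embeds_trans lM.
exact: (universal_linfty (infinite_setN0 K_infinite)).
Qed.
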